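(* Let $G$ be a bipartite graph with respect to the finite lists of distinct vertices $\sigma$ and $\pi$. Let $u\in\pi$ and let $H=G\setminus\{u\}$ be $G$ with all edges incident to $u$ removed. Then either $$\text{online-match}(G,\pi,\sigma)=\text{online-match}(H,\pi,\sigma),$$ or the edge set $\text{online-match}(G,\pi,\sigma)\oplus\text{online-match}(H,\pi,\sigma)$ (symmetric difference) can be ordered into a path (i.e. it is exactly the set of edges $\{w_i,w_{i+1}\}$ of some list $[w_1,\dots,w_k]$ of distinct vertices) that is alternating with respect to $\text{online-match}(G,\pi,\sigma)$ and alternating with respect to $\text{online-match}(H,\pi,\sigma)$, and that starts at $u$ (i.e. $w_1=u$).
   Context: An edge is a set of exactly two vertices; a graph $G$ is a set of edges; $\mathcal V(G)=\bigcup_{e\in G}e$ and $N_G(v)=\{u\mid\{v,u\}\in G\}$. For a vertex set $X$, $G\setminus X=\{e\in G\mid e\cap X=\emptyset\}$. $G$ is bipartite with respect to two vertex sets $A,B$ (or lists, identified with their sets of elements) if $\mathcal V(G)\subseteq A\cup B$ and no edge of $G$ is contained in $A$ or in $B$. For a list $\sigma$ of distinct elements, $\sigma(v)$ is the rank (position, starting at 1) of $v$ in $\sigma$. The procedure online-match$(G,\pi,\sigma)$: start with $R=\emptyset$; process the vertices $u$ of $\pi$ in order; if $N_G(u)\setminus\mathcal V(R)\neq\emptyset$, add to $R$ the edge $\{v,u\}$, where $v$ is the vertex of $N_G(u)\setminus\mathcal V(R)$ with minimum rank $\sigma(v)$; otherwise leave $R$ unchanged. The output is the final $R$. A list of distinct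 vertices $[w_1,\dots,w_k]$ is a path with respect to $G$ if $\{w_i,w_{i+1}\}\in G$ for all $1\le i<k$. It is alternating with respect to an edge set $E$ if either all edges $\{w_i,w_{i+1}\}$ with $i$ even are in $E$ and all those with $i$ odd are not in $E$, or all those with $i$ odd are in $E$ and all those with $i$ even are not in $E$. *)

(* Defs.v *)
From mathcomp Require Export all_boot finmap.

Set Implicit Arguments.
Unset Strict Implicit.
Unset Printing Implicit Defensive.

Local Open Scope fset_scope.

Section OnlineMatch.
Variable T : choiceType.
Implicit Types (G E R : {fset {fset T}}) (A B X : {fset T}) (s p w : seq T).

Definition is_graph G : Prop := forall e, e \in G -> #|` e| = 2.

Definition vertices G : {fset T} := \bigcup_(e <- G) e.

Definition neighbors G (v : T) : {fset T} :=
  [fset x in vertices G | [fset v; x] \in G].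

Definition remove_vertices G X : {fset {fset T}} :=
  [fset e in G | e `&` X == fset0].

Definition bipartite G A B : Prop :=
  vertices G `<=` A `|` B /\
  (forall e, e \in G -> ~~ (e `<=` A) /\ ~~ (e `<=` B)).

(* Ranks start at 1; an element outside s has rank (size s).+1, a case that
   does not arise for the neighbors of a vertex of p when G is bipartite with
   respect to s and p. *)
Definition rank s (v : T) : nat := (index v s).+1.

(* The pick fails exactly when N is empty, since every nonempty finite set has
   an element of minimum rank; this element is unique when N lies in s. *)
Definition match_step G s R (u : T) : {fset {fset T}} :=
  let N := neighbors G u `\` vertices R in
  if [pick v : N | [forall x : N, (rank s (val v) <= rank s (val x))%N]] is Some v
  then [fset val v; u] |` R else R.

Definition online_match G p s : {fset {fset T}} :=
  foldl (match_step G s) fset0 p.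

Definition symdiff E1 E2 : {fset {fset T}} := (E1 `\` E2) `|` (E2 `\` E1).

Definition path_edges w : seq {fset T} :=
  [seq [fset q.1; q.2] | q <- zip w (behead w)].

Definition is_path G w : Prop :=
  uniq w /\ all (fun e => e \in G) (path_edges w).

(* The entry of index i in path_edges w is the edge {w_(i+1), w_(i+2)} when the
   vertices of w are numbered from 1, so the parity tested is that of i.+1. *)
Definition alternating E w : Prop :=
  (forall i, i < size (path_edges w) ->
     (nth fset0 (path_edges w) i \in E) = ~~ odd i.+1) \/
  (forall i, i < size (path_edges w) ->
     (nth fset0 (path_edges w) i \in E) = odd i.+1).

End OnlineMatch.

(* Main.v *)
(** Before [u] is processed the two runs agree, and at [u] only the run on [G]
    can add an edge.  Afterwards both runs see the same neighbors, and the
    symmetric difference of the two partial matchings is always a path from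
    [u].  If the path has even length, both runs have the same free vertices on
    the offline side; if it has odd length, its last vertex [v] is free in the
    run on [H] but not in the run on [G], and this is the only difference.  So
    the choices can only differ when [H] matches the current vertex [y] to [v];
    the path is then extended by [y], and by the partner that [G] gives to [y]
    if there is one. *)
Require Import Defs.

Set Implicit Arguments.
Unset Strict Implicit.
Unset Printing Implicit Defensive.

Local Open Scope fset_scope.

(** * The choice of a partner of minimum rank *)

Section MinRank.
Variables (T : choiceType) (s : seq T).
Implicit Types (N : {fset T}) (v x : T).

(** The choice inside [match_step], isolated so that two runs can be compared through their
    candidate sets. *)
Definition min_rank N : option T :=
  omap val [pick v : N | [forall x : N, rank s (val v) <= rank s (val x)]].

Lemma min_rankP N v :
  min_rank N = Some v ->
  v \in N /\ {in N, forall x, rank s v <= rank s x}.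
Proof.
rewrite /min_rank; case: pickP => //= z /forallP zmin [<-].
by split=> [|x xN]; [exact: valP | exact: (zmin [` xN])].
Qed.

Lemma min_rank_None N : min_rank N = None -> N = fset0.
Proof.
rewrite /min_rank; case: pickP => //= nomin _.
apply/eqP/contraT => /fset0Pn[x xN].
have [m _ mmin] := @arg_minnP N [` xN] predT (fun z => rank s (val z)) isT.
by have /forallP[] := negbT (nomin m) => z; exact: mmin.
Qed.

(** Inclusion in [s] makes the minimum unique: distinct elements of [s] have distinct indices,
    whereas all elements outside share one rank. *)
Lemma min_rank_eq N v : {subset N <= s} -> v \in N ->
  {in N, forall x, rank s v <= rank s x} -> min_rank N = Some v.
Proof.
move=> Ns vN vmin; case E: (min_rank N) => [z|]; last first.
  by rewrite (min_rank_None E) in vN.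
have [zN zmin] := min_rankP E.
have /eqP: rank s z == rank s v by rewrite eqn_leq zmin // vmin.
case=> eq_index; congr Some.
by rewrite -(nth_index z (Ns _ zN)) eq_index nth_index // Ns.
Qed.

(** The old minimum survives the deletion and stays minimal. *)
Lemma min_rank_del N v : {subset N <= s} -> min_rank N <> Some v ->
  min_rank (N `\ v) = min_rank N.
Proof.
move=> Ns; case E: (min_rank N) => [z|] neq_v; last first.
  by rewrite (min_rank_None E) fset0D -E (min_rank_None E).
have [zN zmin] := min_rankP E.
apply: min_rank_eq => [x /fsetD1P[_ /Ns]//||x /fsetD1P[_ /zmin]//].
by rewrite !inE zN andbT; apply/eqP => eq_zv; case: neq_v; rewrite eq_zv.
Qed.

End MinRank.

(** * Covered vertices, edge lists of paths, and alternation *)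

Section Graphs.
Variable T : choiceType.
Implicit Types (G A B : {fset {fset T}}) (es : seq {fset T}) (s p w : seq T).

Lemma verticesP G x : reflect (exists2 e, e \in G & x \in e) (x \in vertices G).
Proof.
rewrite /vertices; apply: (iffP (bigfcupP _ _ _ xpredT)) => [[e]|[e eG xe]]; last by exists e; rewrite ?eG.
by rewrite andbT => eG xe; exists e.
Qed.

Lemma vertices_add e G x :
  (x \in vertices (e |` G)) = (x \in e) || (x \in vertices G).
Proof.
apply/verticesP/orP => [[f /fset1UP[->|fG] xf]|[xe|/verticesP[f fG xf]]].
- by left.
- by right; apply/verticesP; exists f.
- by exists e; rewrite ?fset1U1.
- by exists f; rewrite // fset1Ur.
Qed.

Lemma edge_notin G e x : x \in e -> x \notin vertices G -> e \notin G.
Proof. by move=> xe; apply: contra => eG; apply/verticesP; exists e. Qed.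

Lemma in_neighbors G v x : (x \in neighbors G v) = ([fset v; x] \in G).
Proof.
rewrite !inE /=; apply: andb_idl => vxG.
by apply/verticesP; exists [fset v; x]; rewrite // !inE eqxx orbT.
Qed.

Lemma match_stepE G s A y :
  match_step G s A y =
  oapp (fun v => [fset v; y] |` A) A
       (min_rank s (neighbors G y `\` vertices A)).
Proof. by rewrite /match_step /min_rank; case: pickP. Qed.

Lemma vertices_match_step G s A y x :
  x \in vertices (match_step G s A y) ->
  [|| x == y, x \in neighbors G y | x \in vertices A].
Proof.
rewrite match_stepE; case E: (min_rank _ _) => [v|] /=; last first.
  by move=> ->; rewrite !orbT.
have [/fsetDP[vN _] _] := min_rankP E.
rewrite vertices_add => /orP[/fset2P[->|->]|->]; rewrite ?eqxx ?orbT //.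
by rewrite vN orbT.
Qed.

Lemma path_edges_rcons x w y :
  path_edges (x :: rcons w y) =
  rcons (path_edges (x :: w)) [fset last x w; y].
Proof.
elim: w x => [|z w IHw] x //.
by rewrite rcons_cons -[LHS]/([fset x; z] :: path_edges (z :: rcons w y)) IHw.
Qed.

Lemma size_path_edges x w : size (path_edges (x :: w)) = size w.
Proof. by rewrite size_map size_zip; apply/minn_idPr/leqnSn. Qed.

(** Entries at odd indices lie in [B], since each entry is in exactly one of the two sets. The first
    entry is from [A] because only the run on [G] can match [u]. *)
Definition zigzag A B es : Prop :=
  (forall e, (e \in es) = (e \in A) (+) (e \in B)) /\
  (forall i, i < size es -> (nth fset0 es i \in A) = ~~ odd i).

(** The new entry gets index [size es], whose parity decides which set it has to come from. *)
Lemma zigzag_addl A B es e : ~~ odd (size es) -> e \notin A -> e \notin B ->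
  zigzag A B es -> zigzag (e |` A) B (rcons es e).
Proof.
move=> ev eA eB [mem alt]; split=> [f|i].
  by rewrite mem_rcons !inE mem; case: eqP => [->|]; rewrite ?(negPf eA) ?(negPf eB).
rewrite size_rcons ltnS leq_eqVlt nth_rcons => /predU1P[->|lt_i].
  by rewrite ltnn eqxx fset1U1 ev.
rewrite lt_i !inE alt //; case: eqP => // eq_e.
by have := mem_nth fset0 lt_i; rewrite mem eq_e (negPf eA) (negPf eB).
Qed.

Lemma zigzag_addr A B es e : odd (size es) -> e \notin A -> e \notin B ->
  zigzag A B es -> zigzag A (e |` B) (rcons es e).
Proof.
move=> od eA eB [mem alt]; split=> [f|i].
  rewrite mem_rcons !inE mem; case: eqP => [->|] //=.
  by rewrite (negPf eA).
rewrite size_rcons ltnS leq_eqVlt nth_rcons => /predU1P[->|lt_i].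
  by rewrite ltnn eqxx (negPf eA) od.
by rewrite lt_i alt.
Qed.

(** An edge new to both sets cancels in the symmetric difference and equals no entry of [es]. *)
Lemma zigzag_add A B es e : e \notin A -> e \notin B ->
  zigzag A B es -> zigzag (e |` A) (e |` B) es.
Proof.
move=> eA eB [mem alt]; split=> [f|i lt_i].
  rewrite !inE mem; case: eqP => [->|] //=.
  by rewrite (negPf eA) (negPf eB).
rewrite !inE alt //; case: eqP => // eq_e.
by have := mem_nth fset0 lt_i; rewrite mem eq_e (negPf eA) (negPf eB).
Qed.

Lemma zigzag_alternating A B w : zigzag A B (path_edges w) ->
  alternating A w /\ alternating B w.
Proof.
(* [odd i.+1] is [~~ odd i], so [A] alternates in the second form and [B], its complement along the
   path, in the first. *)
case=> mem alt; split; [right | left] => i lt_i; first by rewrite alt.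
have := mem_nth fset0 lt_i; rewrite mem alt //=.
by case: (odd i); case: (_ \in B).
Qed.

Lemma zigzag_symdiff A B es : zigzag A B es -> [fset e in es] = symdiff A B.
Proof.
case=> mem _; apply/fsetP => e; rewrite !inE /= mem.
by case: (e \in A); case: (e \in B).
Qed.

End Graphs.

(** * The invariant and its preservation by one step of both runs *)

Section Runs.
Variables (T : choiceType) (G : {fset {fset T}}) (s p : seq T) (u : T).
Hypothesis p_nbr : {in p, forall y x, x \in neighbors G y ->
                     x \in s /\ x \notin p}.
Implicit Types (A B : {fset {fset T}}) (q w : seq T).

(* [A] and [B] are the matchings of the runs on [G] and [H], [q] is the part of
   [p] still to be processed, and [u :: w] orders [symdiff A B]. *)
Record diff_path q A B w : Prop := DiffPath {
  diff_uniq : uniq (u :: w);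
  diff_zigzag : zigzag A B (path_edges (u :: w));
  diff_fresh : {in q, forall x,
    [/\ x \notin vertices A, x \notin vertices B & x \notin u :: w]};
  diff_covered : {in u :: w, forall x, x \notin p -> x \in vertices A};
  diff_free : forall x, x \notin p ->
    (x \in vertices A) =
    (x \in vertices B) || odd (size w) && (x == last u w) }.

(** The common edge is new to both matchings because [y] is still fresh, so it cancels and the path
    stays the same. *)
Lemma diff_path_both y z q A B w : y \in p -> z \notin p ->
  uniq (y :: q) -> {subset q <= p} -> diff_path (y :: q) A B w ->
  diff_path q ([fset z; y] |` A) ([fset z; y] |` B) w.
Proof.
move=> yp zp /=/andP[yq _] qp [Uw Zw fresh cov free].
have [yA yB _] := fresh y (mem_head _ _).
have ye : y \in [fset z; y] by rewrite !inE eqxx orbT.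
split=> //.
- by apply: zigzag_add; rewrite // (edge_notin ye).
- move=> x xq; have [xA xB xw] := fresh x (@mem_behead _ (y :: q) x xq).
  have /negPf xe : x \notin [fset z; y].
    apply/fset2P => -[] eq_x; first by rewrite -eq_x qp in zp.
    by rewrite -eq_x xq in yq.
  by rewrite !vertices_add xe.
- by move=> x xw xp; rewrite vertices_add cov ?orbT.
- by move=> x xp; rewrite !vertices_add free // orbA.
Qed.

(** A move of the run on [H] alone: it covers the only offline vertex on which the matchings
    differed, so the exception in [diff_free] disappears as the length becomes even. *)
Lemma diff_path_addr y q A B w : y \in p -> odd (size w) -> last u w \notin p ->
  uniq (y :: q) -> {subset q <= p} -> diff_path (y :: q) A B w ->
  diff_path q A ([fset last u w; y] |` B) (rcons w y).
Proof.
move=> yp od vp /=/andP[yq _] qp [Uw Zw fresh cov free].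
have [yA yB yw] := fresh y (mem_head _ _).
have ye : y \in [fset last u w; y] by rewrite !inE eqxx orbT.
split.
- by rewrite -rcons_cons rcons_uniq yw.
- rewrite path_edges_rcons; apply: zigzag_addr; rewrite ?size_path_edges //;
  by rewrite (edge_notin ye).
- move=> x xq; have [xA xB xw] := fresh x (@mem_behead _ (y :: q) x xq).
  have neq_xy : x != y by apply: contraNneq yq => <-.
  have neq_xv : x != last u w.
    by apply: contraNneq vp => <-; apply: qp.
  split=> //; first by rewrite vertices_add in_fset2 !negb_or neq_xv neq_xy.
  by rewrite -rcons_cons mem_rcons in_cons negb_or neq_xy.
- move=> x; rewrite -rcons_cons mem_rcons inE => /predU1P[->|]; last exact: cov.
  by rewrite yp.
- move=> x xp; rewrite vertices_add free // size_rcons /= od /= orbF !inE.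
  have /negPf -> : x != y by apply: contraNneq xp => ->.
  by rewrite orbF orbC.
Qed.

(** A move of the run on [G] alone: the new end [z] becomes the exception in [diff_free]. This
    serves both for the first edge at [u] and for the answer to a move of the run on [H]. *)
Lemma diff_path_addl z q A B w : ~~ odd (size w) -> last u w \in p ->
  last u w \notin q -> last u w \notin vertices A ->
  z \notin p -> z \notin vertices A -> {subset q <= p} ->
  diff_path q A B w ->
  diff_path q ([fset z; last u w] |` A) B (rcons w z).
Proof.
move=> ev yp yq yA zp zA qp [Uw Zw fresh cov free].
have zB : z \notin vertices B.
  by move: zA; rewrite free // (negPf ev) orbF.
have ze : z \in [fset z; last u w] by rewrite !inE eqxx.
split.
- rewrite -rcons_cons rcons_uniq Uw andbT.
  (* Offline vertices of the path are covered by [A], so the free vertex [z] is not among them. *)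
  by apply: contra zA => zw; apply: cov.
- rewrite path_edges_rcons [X in rcons _ X]fsetUC.
  by apply: zigzag_addl; rewrite ?size_path_edges // (edge_notin ze).
- move=> x xq; have [xA xB xw] := fresh x xq.
  have neq_xz : x != z by apply: contraNneq zp => <-; apply: qp.
  have neq_xy : x != last u w by apply: contraNneq yq => <-.
  split=> //; first by rewrite vertices_add in_fset2 !negb_or neq_xz neq_xy.
  by rewrite -rcons_cons mem_rcons in_cons negb_or neq_xz.
- move=> x; rewrite -rcons_cons mem_rcons inE vertices_add.
  by case/predU1P=> [->|xw /(cov _ xw) ->]; rewrite ?ze ?orbT.
- move=> x xp; rewrite vertices_add free // size_rcons /= (negPf ev) last_rcons.
  rewrite !inE /= orbF orbC.
  have /negPf -> : x != last u w by apply: contraNneq xp => ->.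
  by rewrite orbF.
Qed.

Lemma diff_path_skip y q A B w :
  diff_path (y :: q) A B w -> diff_path q A B w.
Proof.
by case=> Uw Zw fresh cov free; split=> // x xq; apply: fresh; rewrite inE xq orbT.
Qed.

Lemma diff_path_step y q A B w :
  uniq (y :: q) -> {subset y :: q <= p} -> diff_path (y :: q) A B w ->
  exists w', diff_path q (match_step G s A y) (match_step G s B y) w'.
Proof.
move=> Uyq yqp Dw; rewrite !match_stepE.
have yp : y \in p by apply: yqp; rewrite mem_head.
have qp : {subset q <= p} by move=> x xq; apply: yqp; rewrite inE xq orbT.
set NA := neighbors G y `\` _; set NB := neighbors G y `\` _.
have NBP x : x \in NB -> x \in s /\ x \notin p.
  by case/fsetDP=> /(p_nbr yp).
have NBs : {subset NB <= s} by move=> x /NBP[].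
(* Equal choices add one edge to both matchings or none at all, so [w] itself still works. *)
have same : min_rank s NA = min_rank s NB ->
  exists w', diff_path q
    (oapp (fun v => [fset v; y] |` A) A (min_rank s NA))
    (oapp (fun v => [fset v; y] |` B) B (min_rank s NB)) w'.
  move=> ->; exists w; case E: (min_rank s NB) => [z|] /=.
    have [/NBP[_ zp] _] := min_rankP E.
    exact: diff_path_both Dw.
  exact: diff_path_skip Dw.
(* Even length: both runs see the same candidates. *)
case od: (odd (size w)); last first.
  apply: same; congr min_rank; apply/fsetP => x; rewrite !in_fsetD.
  case xN: (x \in neighbors G y); rewrite ?andbF ?andbT //.
  by rewrite (diff_free Dw (p_nbr yp xN).2) od orbF.
(* Odd length: the end of the path is the one candidate that the run on [G] can miss. *)
have NAE : NA = NB `\ last u w.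
  apply/fsetP => x; rewrite in_fsetD1 !in_fsetD.
  case xN: (x \in neighbors G y); rewrite ?andbF ?andbT //.
  by rewrite (diff_free Dw (p_nbr yp xN).2) od negb_or andbC.
have [Ev|/eqP nEv] := eqVneq (min_rank s NB) (Some (last u w)); last first.
  by apply: same; rewrite NAE min_rank_del.
have [/NBP[_ vp] _] := min_rankP Ev.
have D1 := diff_path_addr yp od vp Uyq qp Dw.
rewrite Ev /=; case EA: (min_rank s NA) => [z|] /=; last by exists (rcons w y).
have [zNA _] := min_rankP EA; case/fsetDP: (zNA) => zN zA.
(* [D1] gives freshness only on [q]; that [A] does not cover [y] comes from the state before the
   step. *)
have [yA _ _] := diff_fresh Dw (mem_head _ _).
exists (rcons (rcons w y) z).
have := @diff_path_addl z q _ _ _ _ _ _ _ _ _ qp D1.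
rewrite last_rcons size_rcons /= od; apply=> //.
  by case/andP: Uyq.
by case: (p_nbr yp zN).
Qed.

Lemma diff_path_run q A B w :
  uniq q -> {subset q <= p} -> diff_path q A B w ->
  exists w', diff_path [::] (foldl (match_step G s) A q)
                            (foldl (match_step G s) B q) w'.
Proof.
elim: q A B w => [|y q IHq] A B w Uq qp Dw; first by exists w.
have [w' Dw'] := diff_path_step Uq qp Dw.
apply: IHq Dw' => [|x xq]; first by case/andP: Uq.
by apply: qp; rewrite inE xq orbT.
Qed.

(** A step newly covers at most its own vertex and a neighbor of it, which is offline; so a vertex
    of [p] gets covered only in its own turn. *)
Lemma vertices_run q A x : {subset q <= p} -> x \in p ->
  x \in vertices (foldl (match_step G s) A q) ->
  (x \in q) || (x \in vertices A).
Proof.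
elim: q A => [|y q IHq] A // qp xp /IHq.
rewrite inE => IH; have /IH/(_ xp) : {subset q <= p}.
  by move=> z zq; apply: qp; rewrite inE zq orbT.
case/orP=> [->|/vertices_match_step]; first by rewrite orbT.
case/or3P=> [->|/(p_nbr (qp _ (mem_head _ _)))[_]|->]; rewrite ?orbT //.
by rewrite xp.
Qed.

End Runs.

(** * From bipartiteness and the two runs to the theorem *)

Lemma bipartite_neighbors (T : choiceType) (G : {fset {fset T}})
    (s p : seq T) (y x : T) :
  bipartite G [fset z in s] [fset z in p] -> y \in p ->
  x \in neighbors G y -> x \in s /\ x \notin p.
Proof.
case=> /fsubsetP VG edge yp xN; have := xN; rewrite in_neighbors => /edge[_].
rewrite fsubUset !fsub1set !inE /= yp /= => xp; split=> //.
have /VG : x \in vertices G by case/imfsetP: xN => z /andP[? _] ->.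
by rewrite !inE /= (negPf xp) orbF.
Qed.

Theorem lemma3 (T : choiceType) (G : {fset {fset T}}) (sigma pi : seq T)
  (Ggraph : is_graph G) (sigma_uniq : uniq sigma) (pi_uniq : uniq pi)
  (Gbip : bipartite G [fset x in sigma] [fset x in pi])
  (u : T) (u_pi : u \in pi) :
  let H := remove_vertices G [fset u] in
  let MG := online_match G pi sigma in
  let MH := online_match H pi sigma in
  MG = MH \/
  exists w : seq T,
    [/\ is_path (symdiff MG MH) w,
        [fset e in path_edges w] = symdiff MG MH,
        alternating MG w, alternating MH w & ohead w = Some u].
Proof.
(* Equal outputs are covered too: the one-vertex list [[:: u]] orders the empty symmetric
   difference. *)
move=> H MG MH; right.
have nbrP : {in pi, forall y x, x \in neighbors G y ->
               x \in sigma /\ x \notin pi}.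
  by move=> y yp x; apply: bipartite_neighbors.
have HE e : (e \in H) = (e \in G) && (u \notin e).
  by rewrite !inE /= fsetI_eq0 fdisjointX1.
(* [u] is online, hence not a neighbor of another online [y], and all edges at [y] survive in
   [H]. *)
have stepH y A : y \in pi -> y != u ->
    match_step H sigma A y = match_step G sigma A y.
  move=> yp neq_yu; rewrite !match_stepE; congr (oapp _ _ (min_rank _ (_ `\` _))).
  apply/fsetP => x; rewrite !in_neighbors HE !inE negb_or eq_sym neq_yu /=.
  apply: andb_idr; rewrite -in_neighbors => /(nbrP _ yp)[_].
  by apply: contraNneq => <-.
have stepHu A : match_step H sigma A u = A.
  rewrite match_stepE; case E: (min_rank _ _) => [v|] //.
  have [/fsetDP[] ] := min_rankP E.
  by rewrite in_neighbors HE !inE eqxx andbF.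
have runH q A : {subset q <= pi} -> u \notin q ->
    foldl (match_step H sigma) A q = foldl (match_step G sigma) A q.
  elim: q A => //= y q IHq A qp; rewrite inE negb_or => /andP[neq_uy uq].
  rewrite stepH ?qp ?mem_head 1?eq_sym // IHq // => x xq.
  by rewrite qp // inE xq orbT.
have [p1 [p2 defpi]] : exists p1 p2, pi = p1 ++ u :: p2.
  by case/splitPr: u_pi => p1 p2; exists p1, p2.
have p1p : {subset p1 <= pi} by move=> x xp; rewrite defpi mem_cat xp.
have p2p : {subset p2 <= pi}.
  by move=> x xp; rewrite defpi mem_cat inE xp !orbT.
have := pi_uniq; rewrite defpi cat_uniq /= negb_or.
case/and4P=> _ /andP[up1 /hasPn p12] up2 Up2.
pose R := foldl (match_step G sigma) fset0 p1.
have fresh x : x \in pi -> x \notin p1 -> x \notin vertices R.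
  move=> xp xp1; apply/negP => /(vertices_run nbrP p1p xp).
  by rewrite (negPf xp1) /= => /verticesP[e]; rewrite inE.
have defMG : MG = foldl (match_step G sigma) (match_step G sigma R u) p2.
  by rewrite /MG /online_match defpi foldl_cat.
have defMH : MH = foldl (match_step G sigma) R p2.
  by rewrite /MH /online_match defpi foldl_cat /= stepHu !runH.
(* Just before the turn of [u] the matchings coincide and the path is [u] alone. *)
have D0 : diff_path pi u p2 R R [::].
  split=> //.
  - by split=> // e; rewrite addbb.
  - move=> x xp2; have xR := fresh x (p2p _ xp2) (p12 _ xp2).
    by split=> //; rewrite inE; apply: contraNneq up2 => <-.
  - by move=> x; rewrite inE => /eqP->; rewrite u_pi.
  - by move=> x; rewrite orbF.
have [w1 D1] : exists w1, diff_path pi u p2 (match_step G sigma R u) R w1.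
  rewrite match_stepE; case E: (min_rank _ _) => [z|] /=; last by exists [::].
  have [/fsetDP[zN zR] _] := min_rankP E.
  (* With an empty [w] the end of the path is [u], so its partner [z] in [G] gives the first
     edge. *)
  exists [:: z]; apply: (@diff_path_addl _ _ u z p2 R R [::]) => //.
    exact: fresh.
  by case: (nbrP _ u_pi _ zN).
have [w] := diff_path_run nbrP Up2 p2p D1.
rewrite -defMG -defMH => -[Uw Zw _ _ _].
have eqE := zigzag_symdiff Zw; have [altG altH] := zigzag_alternating Zw.
exists (u :: w); split=> //; split=> //.
by apply/allP => e; rewrite -eqE inE.
Qed.
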